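(* Let $(X,\rho)$ be a metric space and let $\mathcal{B}$ be a bornology on $X$ with a closed base. Then $$d(\tau^s_{\mathcal B})\le cf(\mathcal B)\cdot 2^{<\delta_1^s(X,\mathcal B)}.$$
   Context: A bornology on a set $X$ is a family $\mathcal B$ of subsets of $X$ that is closed under taking subsets, closed under finite unions, and satisfies $\bigcup\mathcal B=X$. A base of $\mathcal B$ is a subfamily $\mathcal B_0\subset\mathcal B$ such that every $B\in\mathcal B$ is contained in some $B_0\in\mathcal B_0$; $\mathcal B$ has a closed base if it has a base consisting of closed sets (equivalently $\overline B\in\mathcal B$ for all $B\in\mathcal B$). Put $cf(\mathcal B)=\aleph_0+\min\{|\mathcal B_0|:\mathcal B_0\text{ is a base of }\mathcal B\}$. For $B\subset X$ and $\epsilon>0$, $B^\epsilon=\{x\in X:\exists b\in B,\ \rho(x,b)<\epsilon\}$. A set $S\subset X$ is a shield for $A\subset X$ if for every closed $C\subset X$ with $C\cap S=\emptyset$ there is $\epsilon>0$ with $C\cap A^\epsilon=\emptyset$. For a space $Y$, $\delta(Y)$ is $\aleph_0$ plus the least cardinal $\mathfrak m$ such that every open cover of $Y$ has a subcover of cardinality $<\mathfrak m$. For $B\subset X$, $\delta_1^s(B)=\aleph_0+\min\{\delta(S):S\text{ is a closed shield for }B\}$, and $\delta_1^s(X,\mathcal B)=\sup\{\delta_1^s(\overline B):B\in\mathcal B\}$. For cardinals, $\kappa^{<\lambda}=\sup\{\kappa^{\mathfrak m}:\mathfrak m<\lambda\}$. $C(X)$ is the set of continuous functions $X\to\mathbb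 R$. The topology $\tau^s_{\mathcal B}$ on $C(X)$ is induced by the uniformity with basic entourages $[B,\epsilon]^s=\{(f,g):\exists\delta>0\ \forall x\in B^\delta,\ |f(x)-g(x)|<\epsilon\}$, where $B\in\mathcal B$, $\epsilon>0$. $d(\tau^s_{\mathcal B})$ is the density of $(C(X),\tau^s_{\mathcal B})$. Convention: all cardinal functions are taken to be infinite, i.e. $\aleph_0$ is added to their value. *)

(* Defs.v *)
From HB Require Import structures.
From mathcomp Require Import all_boot all_order all_algebra.
From mathcomp Require Import all_classical all_reals all_analysis.
Set Implicit Arguments.
Unset Strict Implicit.
Unset Printing Implicit Defensive.
Import Order.TTheory GRing.Theory Num.Theory.
Import numFieldNormedType.Exports.
Local Open Scope classical_set_scope.
Local Open Scope card_scope.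
Local Open Scope ring_scope.

(** * Cardinals *)

(* A cardinal is represented by any type of that cardinality.  The order is   *)
(* a total preorder, and two types stand for the same cardinal when each is   *)
(* below the other (Cantor_Bernstein).                                        *)
Definition cardinal := Type.

Definition cardinal_le (a b : cardinal) : Prop := [set: a] #<= [set: b].

Definition cardinal_lt (a b : cardinal) : Prop :=
  cardinal_le a b /\ ~ cardinal_le b a.

Definition aleph0 : cardinal := nat.
Definition cardinal_add (a b : cardinal) : cardinal := (a + b)%type.
Definition cardinal_mul (a b : cardinal) : cardinal := (a * b)%type.
Definition cardinal_exp (a b : cardinal) : cardinal := b -> a.

Definition is_least_cardinal (P : cardinal -> Prop) (c : cardinal) : Prop :=
  P c /\ forall a, P a -> cardinal_le c a.

(* Junk value [void] when P is empty; otherwise a least element exists, see   *)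
(* [cardinal_minP] below.                                                     *)
Definition cardinal_min (P : cardinal -> Prop) : cardinal :=
  match pselect (exists c, is_least_cardinal P c) with
  | left exc => sval (cid exc)
  | right _ => void
  end.

Definition cardinal_sup (P : cardinal -> Prop) : cardinal :=
  cardinal_min (fun c => forall a, P a -> cardinal_le a c).

Definition cardinal_weak_exp (k l : cardinal) : cardinal :=
  cardinal_sup (fun c => exists m, cardinal_lt m l /\ c = cardinal_exp k m).

Lemma cardinal_leP (a b : cardinal) :
  cardinal_le a b <-> exists f : a -> b, injective f.
Proof.
split=> [/card_leP[f]|[f finj]].
  exists (fun x => val (f (SigSub (mem_setT x)))) => x y.
  by move=> /val_inj /('inj_f) -/(_ (mem_setT _) (mem_setT _)) [].
rewrite /cardinal_le -(card_le_eql (@inj_card_eq _ _ setT f _)).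
  exact: subset_card_le.
exact: in2W.
Qed.

Lemma cardinal_le_trans (b a c : cardinal) :
  cardinal_le a b -> cardinal_le b c -> cardinal_le a c.
Proof. exact: card_le_trans. Qed.

Lemma cardinal_family_least (I : Type) (i0 : I) (A : I -> cardinal) :
  exists i, forall j, cardinal_le (A i) (A j).
Proof.
pose T := forall i, A i.
pose P (S : set T) := forall i s t, S s -> S t -> s i = t i -> s = t.
have [F FP Ftot|S [PS Smax]] := @Zorn_bigcup T P.
  move=> i s t [X FX Xs] [Y FY Yt].
  have [XY|YX] := Ftot _ _ FX FY.
  - by apply: (FP _ FY i) => //; exact: XY.
  - by apply: (FP _ FX i) => //; exact: YX.
have [[i surj]|nsurj] :=
    pselect (exists i, forall x : A i, exists2 s, S s & s i = x).
  exists i => j; apply/cardinal_leP.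
  pose g x := s2val (cid2 (surj x)).
  have gS x : S (g x) by rewrite /g; case: cid2.
  have gi x : g x i = x by rewrite /g; case: cid2.
  by exists (fun x => g x j) => x y xy;
    rewrite -(gi x) -(gi y) (PS j _ _ (gS x) (gS y) xy).
have ex i : exists x : A i, forall s, S s -> s i <> x.
  apply: contrapT => nx; apply: nsurj; exists i => x; apply: contrapT => ns.
  by apply: nx; exists x => s Ss sx; apply: ns; exists s.
pose t : T := fun i => sval (cid (ex i)).
have tS i s : S s -> s i <> t i by rewrite /t; case: cid => /= x; exact.
have [|] := Smax (S `|` [set t]).
  split; first by move=> ?; left.
  move=> /(_ t (or_intror erefl)) St; exact: (tS i0 t St).
move=> i s u [Ss|->] [Su|->] // e; first exact: (PS i).
- by case: (tS i s Ss).
- by case: (tS i u Su).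
Qed.

Lemma cardinal_le_total (a b : cardinal) : cardinal_le a b \/ cardinal_le b a.
Proof.
have [[] h] := cardinal_family_least true (fun i : bool => if i then a else b).
- by left; exact: (h false).
- by right; exact: (h true).
Qed.

Lemma cardinal_minP (P : cardinal -> Prop) :
  (exists c, P c) -> is_least_cardinal P (cardinal_min P).
Proof.
move=> [a0 Pa0]; rewrite /cardinal_min.
case: pselect => [exc|nex]; first by case: cid.
exfalso; apply: nex.
pose Q (S : a0 -> Prop) :=
  exists a, [/\ P a, cardinal_le a {x | S x} & cardinal_le {x | S x} a].
have toQ a : P a -> cardinal_le a a0 ->
    exists S, Q S /\ cardinal_le {x | S x} a.
  move=> Pa /cardinal_leP[f finj].
  pose S y := exists x, f x = y.
  have SA : cardinal_le {x | S x} a.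
    pose h (y : {y | S y}) : a := sval (cid (proj2_sig y)).
    have hK y : f (h y) = sval y by rewrite /h; case: cid.
    apply/cardinal_leP; exists h => -[x Sx] [y Sy] xy.
    by apply: eq_exist; rewrite -[x]/(sval (exist S x Sx)) -hK xy hK.
  exists S; split => //; exists a; split => //.
  apply/cardinal_leP; exists (fun x => exist S (f x) (ex_intro _ x erefl)).
  by move=> x y [/finj].
have [S0 [QS0 S0a0]] := toQ _ Pa0 (card_lexx _).
have [[S [a [Pa aS Sa]]] least] :=
  cardinal_family_least (exist Q S0 QS0) (fun S : {S | Q S} => {x | sval S x}).
exists a; split=> // b Pb.
have [ba0|a0b] := cardinal_le_total b a0.
  have [S' [QS' S'b]] := toQ _ Pb ba0.
  apply: (cardinal_le_trans aS); apply: cardinal_le_trans S'b.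
  exact: (least (exist Q S' QS')).
apply: (cardinal_le_trans aS); apply: cardinal_le_trans a0b.
apply: cardinal_le_trans S0a0.
exact: (least (exist Q S0 QS0)).
Qed.

Lemma cardinal_supP (P : cardinal -> Prop) :
  (exists b, forall a, P a -> cardinal_le a b) ->
  is_least_cardinal (fun c => forall a, P a -> cardinal_le a c)
    (cardinal_sup P).
Proof. exact: cardinal_minP. Qed.

Lemma cardinal_lt_pow (a : cardinal) : cardinal_lt a (cardinal_exp bool a).
Proof.
split.
  apply/cardinal_leP; exists (fun x y => `[< x = y >]) => x y xy.
  by apply/esym/asboolP; rewrite -[`[< _ >]]/((fun z => `[< y = z >]) x) -xy;
    apply/asboolP.
move=> /cardinal_leP[f finj].
pose D x := `[< forall h, f h = x -> h x = false >].
have [DfD|nDfD] := boolP (D (f D)).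
  by move: (DfD) => /asboolP /(_ D erefl); rewrite DfD.
move/asboolP: (nDfD); apply => h /finj ->; exact/negbTE.
Qed.

Lemma cardinal_weak_exp_bounded (l : cardinal) : exists b, forall a,
  (exists m, cardinal_lt m l /\ a = cardinal_exp bool m) -> cardinal_le a b.
Proof.
exists (cardinal_exp bool l) => _ [m [[/cardinal_leP[f finj] _] ->]].
apply/cardinal_leP; exists (fun h y => `[< exists2 x, f x = y & h x >]).
move=> h k hk.
apply/funext => x; move/(congr1 (fun u => u (f x))): hk.
have E (g : m -> bool) : `[< exists2 z, f z = f x & g z >] = g x.
  by apply/asboolP/idP => [[z /finj -> //]|gx]; exists x.
by rewrite !E.
Qed.

(** * Cardinal functions of topological spaces *)

Definition density (T : topologicalType) : cardinal :=
  cardinal_add aleph0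
    (cardinal_min (fun c => exists D : set T, dense D /\ c = set_type D)).

Definition delta (Y : topologicalType) : cardinal :=
  cardinal_add aleph0
    (cardinal_min (fun m => forall U : set (set Y),
       (forall u, U u -> open u) -> \bigcup_(u in U) u = [set: Y] ->
       exists V : set (set Y),
         [/\ V `<=` U, \bigcup_(v in V) v = [set: Y] &
             cardinal_lt (set_type V) m])).

Lemma density_nonempty (T : topologicalType) :
  exists c, exists D : set T, dense D /\ c = set_type D.
Proof.
by exists (set_type [set: T]), setT; split=> // O O0 _; rewrite setIT.
Qed.

Lemma delta_nonempty (Y : topologicalType) :
  exists m, forall U : set (set Y),
    (forall u, U u -> open u) -> \bigcup_(u in U) u = [set: Y] ->
    exists V : set (set Y),
      [/\ V `<=` U, \bigcup_(v in V) v = [set: Y] &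
          cardinal_lt (set_type V) m].
Proof.
exists (cardinal_exp bool (set Y)) => U _ UY; exists U; split => //.
have Ule : cardinal_le (set_type U) (set Y).
  by apply/cardinal_leP; exists val; exact: val_inj.
have [le nle] := cardinal_lt_pow (set Y).
split; first exact: cardinal_le_trans le.
by move=> h; apply: nle; exact: cardinal_le_trans Ule.
Qed.

(** * Bornologies *)

(* Finite unions include the empty one, so the empty set is always a member.  *)
Record bornology (X : Type) := Bornology {
  bornology_sets : set (set X);
  bornology_sub : forall A B, bornology_sets B -> A `<=` B -> bornology_sets A;
  bornology_finite_bigcup : forall F : set (set X),
    finite_set F -> F `<=` bornology_sets ->
    bornology_sets (\bigcup_(A in F) A);
  bornology_cover : \bigcup_(A in bornology_sets) A = [set: X]
}.

Definition bornology_base (X : Type) (B : bornology X) (B0 : set (set X)) :=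
  B0 `<=` bornology_sets B /\
  forall A, bornology_sets B A -> exists2 A0, B0 A0 & A `<=` A0.

Definition has_closed_base (X : topologicalType) (B : bornology X) :=
  exists B0, bornology_base B B0 /\ forall A, B0 A -> closed A.

Definition cf (X : Type) (B : bornology X) : cardinal :=
  cardinal_add aleph0
    (cardinal_min (fun c => exists B0, bornology_base B B0 /\ c = set_type B0)).

Lemma cf_nonempty (X : Type) (B : bornology X) :
  exists c, exists B0, bornology_base B B0 /\ c = set_type B0.
Proof.
exists (set_type (bornology_sets B)), (bornology_sets B).
by split=> //; split=> // A BA; exists A.
Qed.

Section shields.
Context {R : realType} {X : metricType R}.

Definition enlargement (A : set X) (e : R) : set X :=
  [set x | exists2 a, A a & mdist x a < e].

Definition shield (S A : set X) : Prop :=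
  forall C : set X, closed C -> C `&` S = set0 ->
    exists2 e : R, 0 < e & C `&` enlargement A e = set0.

Definition delta1s (A : set X) : cardinal :=
  cardinal_add aleph0
    (cardinal_min (fun c => exists S : set X,
       [/\ closed S, shield S A & c = delta (set_type S)])).

Definition delta1s_bornology (B : bornology X) : cardinal :=
  cardinal_add aleph0
    (cardinal_sup (fun c =>
       exists A, bornology_sets B A /\ c = delta1s (closure A))).

Lemma delta1s_nonempty (A : set X) : exists c, exists S : set X,
  [/\ closed S, shield S A & c = delta (set_type S)].
Proof.
exists (delta (set_type [set: X])), setT; split => // C _; rewrite setIT => ->.
by exists 1; rewrite ?set0I.
Qed.

Lemma delta1s_bornology_bounded (B : bornology X) : exists b, forall c,
  (exists A, bornology_sets B A /\ c = delta1s (closure A)) -> cardinal_le c b.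
Proof.
exists {A : set X & delta1s (closure A)} => _ [A [_ ->]].
apply/cardinal_leP; exists (existT (fun A => delta1s (closure A)) A) => x y xy.
by have := projT2_eq xy; rewrite (Prop_irrelevance (projT1_eq xy) erefl).
Qed.

End shields.

(** * The topology of strong uniform convergence on a bornology *)

Section strong_uniform_convergence.
Context {R : realType} {X : metricType R}.

Definition strong_entourage (A : set X) (e : R) :
    set (continuousType X R * continuousType X R) :=
  [set fg : continuousType X R * continuousType X R |
    exists2 d : R, 0 < d &
    forall x, enlargement A d x -> `|fg.1 x - fg.2 x| < e].

(* C(X) with the uniformity generated by the sets [strong_entourage A e].     *)
Definition strong_continuous (B : bornology X) : Type := continuousType X R.

Variable B : bornology X.

HB.instance Definition _ := Choice.on (strong_continuous B).

Definition strong_ent :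
    set_system (strong_continuous B * strong_continuous B) :=
  filter_from [set Ae : set X * R | bornology_sets B Ae.1 /\ 0 < Ae.2]
    (fun Ae => strong_entourage Ae.1 Ae.2).

Lemma bornology0 : bornology_sets B set0.
Proof.
have -> : set0 = \bigcup_(A in (set0 : set (set X))) A by rewrite bigcup_set0.
exact: bornology_finite_bigcup.
Qed.

Lemma bornologyU (A1 A2 : set X) : 
  bornology_sets B A1 -> bornology_sets B A2 -> bornology_sets B (A1 `|` A2).
Proof.
move=> BA1 BA2; rewrite -(bigcup2E A1 A2).
have -> : \bigcup_i bigcup2 A1 A2 i = \bigcup_(A in [set A1; A2]) A.
  by rewrite bigcup2E bigcup_setU !bigcup_set1.
apply: bornology_finite_bigcup; last by move=> A [->|->].
exact: finite_set2.
Qed.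

Let strong_ent_filter : Filter strong_ent.
Proof.
apply: filter_from_filter.
  by exists (set0, 1); split; [exact: bornology0|].
move=> [A1 e1] [A2 e2] /= [BA1 e10] [BA2 e20].
exists (A1 `|` A2, Num.min e1 e2) => /=.
  by split; [exact: bornologyU|rewrite lt_min e10].
move=> [f g] /= [d d0 fg]; split; exists d => // x [a Aa xa].
  by have := fg x; rewrite lt_min => /(_ _)/andP[]//; exists a => //; left.
by have := fg x; rewrite lt_min => /(_ _)/andP[]//; exists a => //; right.
Qed.

Local Open Scope relation_scope.

Let strong_ent_diagonal E : strong_ent E -> diagonal `<=` E.
Proof.
move=> [[A e] /= [_ e0] sE] [f g] /= fg; apply: sE; exists 1 => //= x _.
by move: fg; rewrite /diagonal/= => ->; rewrite subrr normr0.
Qed.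

Let strong_ent_inv E : strong_ent E -> strong_ent E^-1.
Proof.
move=> [[A e] /= Ae sE]; exists (A, e) => // -[f g] /= [d d0 fg].
by apply: sE; exists d => // x Ax /=; rewrite distrC; exact: fg.
Qed.

Let strong_ent_split E : strong_ent E ->
  exists2 F, strong_ent F & F \; F `<=` E.
Proof.
move=> [[A e] /= [BA e0] sE]; exists (strong_entourage A (e / 2)).
  by exists (A, e / 2) => //=; split=> //; exact: divr_gt0.
move=> [f h] /= [g [d1 d10 fg] [d2 d20 gh]]; apply: sE => /=.
exists (Num.min d1 d2) => /=; first by rewrite lt_min d10.
move=> x [a Aa]; rewrite lt_min => /andP[xa1 xa2].
rewrite -(subrKA (g x)) [e]splitr (le_lt_trans (ler_normD _ _))// ltrD//.
- by apply: fg; exists a.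
- by apply: gh; exists a.
Qed.

HB.instance Definition _ := isUniform.Build (strong_continuous B)
  strong_ent_filter strong_ent_diagonal strong_ent_inv strong_ent_split.

Lemma entourage_strongE : @entourage (strong_continuous B) = strong_ent.
Proof. by []. Qed.

Lemma nbhs_strongE (f : strong_continuous B) :
  nbhs f = filter_from [set Ae : set X * R | bornology_sets B Ae.1 /\ 0 < Ae.2]
    (fun Ae => [set g | strong_entourage Ae.1 Ae.2 (f, g)]).
Proof.
apply/seteqP; split=> U.
  move=> [E [[A e] Ae sE] sU]; exists (A, e) => // g fg.
  by apply: sU; exact/mem_set/sE.
move=> [[A e] Ae sU]; exists (strong_entourage A e); first by exists (A, e).
by move=> g /set_mem /sU.
Qed.

End strong_uniform_convergence.

(* Main.v *)
(* Fix A in a base of B and a closed shield S of its closure.  If |f - g| < e *)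
(* on S, then {|f - g| >= e} is a closed set missing S, hence missing an      *)
(* enlargement of A.  It therefore suffices that, uniformly on S, C(X) can be *)
(* approximated from a set of at most 2^{<l} functions, l = delta1s(X, B).    *)
(*                                                                            *)
(* Let A_n be a maximal 1/(n+1)-separated subset of S; being closed and       *)
(* discrete in S, it has fewer than delta(S) <= l points.  Given f and e, let *)
(* F_n be the set of points of S not within 1/(n+1) of any a in A_n near      *)
(* which f varies by less than e.  Every point of S has a neighbourhood that  *)
(* misses F_n for all large n.  Some F_n lies in the closure of a set D with  *)
(* |D| < l: otherwise pick separated sets T_n in F_n, with |T_n| >= |A_n|     *)
(* whenever A_n is infinite; their union T is locally finite, so |T| < l, and *)
(* it is infinite, so the union of the A_n has cardinality at most |T|, and   *)
(* it is dense in S.  Up to 3e, f is now determined on S by n, by the good    *)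
(* points of A_n with the values of f there rounded to multiples of e, and by *)
(* the rounded values of f on D, where D may be chosen as a function of the   *)
(* earlier data.  As |A_n|, |D| < l, there are at most 2^{<l} such codes.     *)
Require Import Defs.
From mathcomp Require Import all_boot all_order all_algebra.
From mathcomp Require Import all_classical all_reals all_analysis.
From mathcomp Require Import ring lra.
Set Implicit Arguments.
Unset Strict Implicit.
Unset Printing Implicit Defensive.
Import Order.TTheory GRing.Theory Num.Theory.
Import numFieldNormedType.Exports.
Local Open Scope classical_set_scope.
Local Open Scope ring_scope.

(** * Cardinal arithmetic *)

(** The factor cf(B) comes from a base of least size: each of its members A gets its own set of at
    most 2^{<l} functions, and the union of these sets is dense. A shield S reduces strong
    approximation on A to uniform approximation on S, which [dense_restrictions] provides. The
    difficulty is that S need not have a dense subset of size below l. Each separated net of S is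
    smaller than l, but the union of the nets may reach size l when l has countable cofinality, and
    coding f by its values there would cost 2^l. So f is coded on a single net, at the points where
    it varies little, and [small_dense_remainder] shows that, for a suitable net, one more set of
    size below l handles the rest of S. Codes are only counted, never decoded:
    [cardinal_representatives] picks one continuous function for each code that occurs, so no
    extension theorem enters. *)

Lemma cardinal_lexx (a : cardinal) : cardinal_le a a.
Proof. exact: card_lexx. Qed.

Lemma cardinal_ltNle (a b : cardinal) : cardinal_lt a b <-> ~ cardinal_le b a.
Proof. by split=> [[]//|nba]; split=> //; have [] := cardinal_le_total a b. Qed.

Lemma cardinal_le_lt_trans (b a c : cardinal) :
  cardinal_le a b -> cardinal_lt b c -> cardinal_lt a c.
Proof.
move=> ab /cardinal_ltNle ncb; apply/cardinal_ltNle => ca.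
exact/ncb/(cardinal_le_trans ca).
Qed.

Lemma cardinal_lt_le_trans (b a c : cardinal) :
  cardinal_lt a b -> cardinal_le b c -> cardinal_lt a c.
Proof.
move=> /cardinal_ltNle nba bc; apply/cardinal_ltNle => ca.
exact/nba/(cardinal_le_trans bc).
Qed.

(** Hides the use of choice, so that injections between subtypes can be given by relations on the
    underlying elements. *)
Lemma cardinal_le_rel (a b : cardinal) (r : a -> b -> Prop) :
  (forall x, exists y, r x y) ->
  (forall x x' y, r x y -> r x' y -> x = x') -> cardinal_le a b.
Proof.
move=> tot inj; apply/cardinal_leP; exists (fun x => sval (cid (tot x))).
move=> x x'; case: cid => y rxy; case: cid => y' rx'y' /= yy'.
by apply: inj rxy _; rewrite yy'.
Qed.

Lemma cardinal_le_surj (a b : cardinal) (f : b -> a) :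
  (forall x, exists y, f y = x) -> cardinal_le a b.
Proof. by move=> fs; apply: (cardinal_le_rel fs) => x x' y -> ->. Qed.

Lemma cardinal_le_set (T : Type) (A : set T) : cardinal_le A T.
Proof. by apply/cardinal_leP; exists val; exact: val_inj. Qed.

Lemma cardinal_le_subset (T : Type) (A B : set T) :
  A `<=` B -> cardinal_le A B.
Proof.
move=> AB; rewrite /cardinal_le (card_le_eql (card_setT A)).
by rewrite (card_le_eqr (card_setT B)); exact: subset_card_le.
Qed.

Lemma cardinal_le_mul (a b c d : cardinal) :
  cardinal_le a c -> cardinal_le b d ->
  cardinal_le (cardinal_mul a b) (cardinal_mul c d).
Proof.
move=> /cardinal_leP[f finj] /cardinal_leP[g ginj]; apply/cardinal_leP.
by exists (fun p => (f p.1, g p.2)) => -[x y] [x' y'] /= [/finj -> /ginj ->].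
Qed.

Lemma cardinal_le_mulr (a b : cardinal) : a -> cardinal_le b (cardinal_mul a b).
Proof. by move=> x; apply/cardinal_leP; exists (pair x) => y y' []. Qed.

Lemma cardinal_add_le_square (a b c : cardinal) :
  cardinal_le aleph0 c -> cardinal_le a c -> cardinal_le b c ->
  cardinal_le (cardinal_add a b) (cardinal_mul c c).
Proof.
move=> /cardinal_leP[h hinj] /cardinal_leP[f finj] /cardinal_leP[g ginj].
apply/cardinal_leP.
exists (fun s => match s with
  inl x => (h 0%N, f x) | inr y => (h 1%N, g y) end).
move=> [x|x] [y|y] [].
- by move=> /finj ->.
- by move=> /hinj.
- by move=> /hinj.
- by move=> /ginj ->.
Qed.

(** * Hessenberg's theorem and its corollaries *)

(** The graph of an injection from D * D into D, with D read off the diagonal. Graphs are sets of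
    triples, so Zorn's lemma for unions of chains applies to them. *)
Definition square_injection (T : Type) (G : set (T * T * T)) : Prop :=
  let D := [set x | exists z, G (x, x, z)] in
  [/\ forall p z z', G (p, z) -> G (p, z') -> z = z',
      forall p p' z, G (p, z) -> G (p', z) -> p = p',
      forall x y z, G (x, y, z) -> [/\ D x, D y & D z] &
      forall x y, D x -> D y -> exists z, G (x, y, z)].

(** Each condition involves at most two triples of the union, and these already lie in a common
    member of the chain. *)
Lemma square_injection_bigcup (T : Type) (F : set (set (T * T * T))) :
  (forall G, F G -> square_injection G) -> total_on F subset ->
  square_injection (\bigcup_(G in F) G).
Proof.
move=> Fsq Ftot.
have up G H : F G -> F H -> exists K, [/\ F K, G `<=` K & H `<=` K].
  move=> FG FH; have [GH|HG] := Ftot _ _ FG FH; [exists H|exists G]; split=> //.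
split.
- move=> p z z' [G FG Gz] [H FH Hz].
  have [K [/Fsq[fK _ _ _] GK HK]] := up _ _ FG FH.
  by apply: (fK p); [exact: GK|exact: HK].
- move=> p p' z [G FG Gz] [H FH Hz].
  have [K [/Fsq[_ iK _ _] GK HK]] := up _ _ FG FH.
  by apply: (iK _ _ z); [exact: GK|exact: HK].
- move=> x y z [G FG Gz]; have [_ _ /(_ _ _ _ Gz)[] + + + _] := Fsq _ FG.
  by move=> [u Gu] [v Gv] [w Gw]; split; [exists u|exists v|exists w]; exists G.
- move=> x y [u [G FG Gu]] [v [H FH Hv]].
  have [K [FK GK HK]] := up _ _ FG FH; have [_ _ _ tK] := Fsq _ FK.
  have [||z Kz] := tK x y; first by exists u; exact: GK.
    by exists v; exact: HK.
  by exists z; exists K.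
Qed.

(* Hessenberg's theorem: a maximal injection from a square Y * Y into Y has a *)
(* domain of full cardinality, since otherwise the complement of Y contains a *)
(* copy of Y, to which the injection can be extended.                         *)
Lemma cardinal_square_le (c : cardinal) :
  cardinal_le aleph0 c -> cardinal_le (cardinal_mul c c) c.
Proof.
move=> /cardinal_leP[h hinj].
pose G0 : set (c * c * c) :=
  [set t | exists i j, t = (h i, h j, h (pickle (i, j)))].
have sq0 : square_injection G0.
  have D0 i : exists z, G0 (h i, h i, z) by exists (h (pickle (i, i))), i, i.
  split.
  - by move=> p z z' [i [j [-> ->]]] [i' [j' [/hinj <- /hinj <- ->]]].
  - move=> p p' z [i [j [-> ->]]] [i' [j' [-> /hinj]]].
    by move/(pcan_inj pickleK) => [-> ->].
  - by move=> x y z [i [j [-> -> ->]]]; split; exact: D0.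
  - move=> x y [_ [i [_ [-> _ _]]]] [_ [j [_ [-> _ _]]]].
    by exists (h (pickle (i, j))), i, j.
(* Adjoining [G0], a copy of the pairing of natural numbers, keeps D infinite and also makes the
   empty chain admissible. *)
pose P G := square_injection (G0 `|` G).
have [F FP Ftot|G [PG Gmax]] := @Zorn_bigcup _ P.
  rewrite /P; have -> : G0 `|` \bigcup_(X in F) X =
      \bigcup_(X in G0 |` [set G0 `|` Y | Y in F]) X.
    rewrite bigcup_setU1 bigcup_image; apply/seteqP; split=> t.
      by move=> [?|[X FX Xt]]; [left|right; exists X => //; right].
    by move=> [?|[X FX [?|Xt]]]; [left|left|right; exists X].
  apply: square_injection_bigcup; first by move=> _ [->|[X /FP PX <-]].
  move=> _ _ [->|[X FX <-]] [->|[Y FY <-]]; [by left|by left| |].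
    by right; exact: subsetUl.
  by have [XY|YX] := Ftot _ _ FX FY; [left|right]; exact: setUS.
rewrite /P in PG Gmax; set H := G0 `|` G in PG.
have [fH iH dH tH] := PG.
pose D := [set x | exists z, H (x, x, z)]; rewrite -/D in dH tH.
have Dinf : cardinal_le aleph0 D.
  have Dh i : D (h i) by exists (h (pickle (i, i))); left; exists i, i.
  apply/cardinal_leP; exists (fun i => SigSub (mem_set (Dh i))).
  by move=> i j [/hinj].
have DD : cardinal_le (cardinal_mul D D) D.
  apply: (@cardinal_le_rel _ _
      (fun p z => H (\val p.1, \val p.2, \val z))) => [[x y]|].
    have [z Hz] := tH _ _ (set_mem (valP x)) (set_mem (valP y)).
    by have [_ _ Dz] := dH _ _ _ Hz; exists (SigSub (mem_set Dz)).
  by move=> [x y] [x' y'] z /= Hz /(iH _ _ _ Hz)[/val_inj -> /val_inj ->].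
have [Dc|] := pselect (cardinal_le (~` D) D).
  have cD : cardinal_le c D.
    apply: cardinal_le_trans DD.
    apply: cardinal_le_trans (cardinal_add_le_square Dinf (cardinal_lexx _) Dc).
    apply: (@cardinal_le_rel _ _ (fun x s =>
      match s with inl y => x = \val y | inr y => x = \val y end)).
      move=> x; have [Dx|Dx] := pselect (D x).
        by exists (inl (SigSub (mem_set Dx))).
      by exists (inr (SigSub (mem_set (Dx : (~` D) x)))).
    by move=> x x' [y|y] -> ->.
  apply: (cardinal_le_trans (cardinal_le_mul cD cD)).
  exact: cardinal_le_trans DD (cardinal_le_set _).
move/cardinal_ltNle=> [/cardinal_leP[g ginj] _]; exfalso.
have gD x : ~ D (\val (g x)) by exact: set_mem (valP (g x)).
pose E := D `|` range (fun x : D => \val (g x)).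
have ED : cardinal_le E D.
  apply: cardinal_le_trans DD.
  apply: cardinal_le_trans
    (cardinal_add_le_square Dinf (cardinal_lexx _) (cardinal_lexx _)).
  apply: (@cardinal_le_rel _ _ (fun x s =>
    match s with inl y => \val x = \val y | inr y => \val x = \val (g y) end)).
    move=> x; have [Dx|[y _ yx]] := set_mem (valP x).
      by exists (inl (SigSub (mem_set Dx))).
    by exists (inr y).
  by move=> x x' [y|y] xy x'y; apply/val_inj; rewrite xy x'y.
have /cardinal_leP[e einj] : cardinal_le (cardinal_mul E E) D.
  exact: cardinal_le_trans (cardinal_le_mul ED ED) DD.
(* Pairs not both in D are sent into the copy of D outside D, so the new values cannot collide with
   those of [H]. *)
pose H' : set (c * c * c) := [set t | ~ (D t.1.1 /\ D t.1.2) /\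
  exists x y : E, t = (\val x, \val y, \val (g (e (x, y))))].
have HD t : H t -> [/\ D t.1.1, D t.1.2 & D t.2].
  by case: t => -[x y] z; exact: dH.
have /cardinal_leP[k _] := Dinf; pose x0 := k 0%N.
have Ex x : E x -> exists z, (H `|` H') (x, x, z).
  have [[z Hz] _|nDx xE] := pselect (D x); first by exists z; left.
  exists (\val (g (e (SigSub (mem_set xE), SigSub (mem_set xE))))); right.
  by split=> /=; [case|exists (SigSub (mem_set xE)), (SigSub (mem_set xE))].
have ExE x z : (H `|` H') (x, x, z) -> E x.
  by move=> [/HD[? _ _]|[_ [u [_ [-> _ _]]]]]; [left|exact: set_mem (valP u)].
have Eg u : E (\val (g u)) by right; exists u.
apply: (Gmax (G `|` H')); last first.
  rewrite setUA -/H; split.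
  - move=> p z z' [Hz|[nD [x [y [pE ->]]]]] [Hz'|[nD' [x' [y' [pE' ->]]]]].
    + exact: fH Hz Hz'.
    + by have [? ? _] := HD _ Hz; case: nD'.
    + by have [? ? _] := HD _ Hz'; case: nD.
    + by move: pE'; rewrite pE => -[/val_inj -> /val_inj ->].
  - move=> p p' z [Hz|[nD [x [y [pE zE]]]]] [Hz'|[nD' [x' [y' [pE' zE']]]]].
    + exact: iH Hz Hz'.
    + by have [_ _] := HD _ Hz; rewrite /= zE' => /gD.
    + by have [_ _] := HD _ Hz'; rewrite /= zE => /gD.
    + by move: zE'; rewrite zE pE pE' => /val_inj/ginj/einj[-> ->].
  - move=> x y z [/HD[/= Dx Dy Dz]|[_ [u [v [-> -> ->]]]]].
      by split; apply: Ex; left.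
    split; apply: Ex; last exact: Eg.
      exact: set_mem (valP u).
    exact: set_mem (valP v).
  - move=> x y [u /ExE xE] [v /ExE yE].
    have [[Dx Dy]|nD] := pselect (D x /\ D y).
      by have [z Hz] := tH _ _ Dx Dy; exists z; left.
    exists (\val (g (e (SigSub (mem_set xE), SigSub (mem_set yE))))); right.
    by split=> //; exists (SigSub (mem_set xE)), (SigSub (mem_set yE)).
(* The extension is strict: its diagonal triple at [g x0] would put [g x0] in D if it belonged to
   [G]. *)
split; first exact: subsetUl.
have [z [/HD[/gD]//|H'z]] := Ex _ (Eg x0).
by move=> /(_ _ (or_intror H'z)) Gz; apply: (gD x0); exists z; right.
Qed.

Lemma cardinal_mul_le (a b c : cardinal) : cardinal_le aleph0 c ->
  cardinal_le a c -> cardinal_le b c -> cardinal_le (cardinal_mul a b) c.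
Proof.
move=> c0 ac bc; apply: cardinal_le_trans (cardinal_square_le c0).
exact: cardinal_le_mul.
Qed.

Lemma cardinal_add_le (a b c : cardinal) : cardinal_le aleph0 c ->
  cardinal_le a c -> cardinal_le b c -> cardinal_le (cardinal_add a b) c.
Proof.
move=> c0 ac bc; apply: cardinal_le_trans (cardinal_square_le c0).
exact: cardinal_add_le_square.
Qed.

Lemma cardinal_sigT_le_mul (I : Type) (F : I -> Type) (c : cardinal) :
  (forall i, cardinal_le (F i) c) ->
  cardinal_le {i & F i} (cardinal_mul I c).
Proof.
move=> Fc; apply/cardinal_leP.
pose g i := sval (cid ((cardinal_leP _ _).1 (Fc i))).
have ginj i : injective (g i) by rewrite /g; case: cid.
exists (fun p => (projT1 p, g _ (projT2 p))) => -[i x] [j y] /= [ij].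
by case: _ / ij y => y /ginj ->.
Qed.

Lemma cardinal_sigT_le (I : Type) (F : I -> Type) (c : cardinal) :
  cardinal_le aleph0 c -> cardinal_le I c -> (forall i, cardinal_le (F i) c) ->
  cardinal_le {i & F i} c.
Proof.
move=> c0 Ic /cardinal_sigT_le_mul /cardinal_le_trans; apply.
exact: cardinal_mul_le (cardinal_lexx _).
Qed.

Lemma cardinal_bigcup_le_mul (T I : Type) (A : I -> set T) (c : cardinal) :
  (forall i, cardinal_le (A i) c) ->
  cardinal_le (\bigcup_i A i) (cardinal_mul I c).
Proof.
move=> Ac; apply: cardinal_le_trans (cardinal_sigT_le_mul Ac).
apply: (@cardinal_le_rel _ _ (fun (x : set_type (\bigcup_i A i))
    (p : {i & set_type (A i)}) => \val x = \val (projT2 p))) => [x|].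
  have [i _ Aix] := set_mem (valP x).
  by exists (existT (fun i => set_type (A i)) i (SigSub (mem_set Aix))).
by move=> x x' p xp x'p; apply/val_inj; rewrite xp x'p.
Qed.

Lemma cardinal_bigcup_le (T I : Type) (A : I -> set T) (c : cardinal) :
  cardinal_le aleph0 c -> cardinal_le I c -> (forall i, cardinal_le (A i) c) ->
  cardinal_le (\bigcup_i A i) c.
Proof.
move=> c0 Ic /cardinal_bigcup_le_mul /cardinal_le_trans; apply.
exact: cardinal_mul_le (cardinal_lexx _).
Qed.

(** * Counting functions by codes *)

(** The representative chosen for a code depends on the code alone, so there are no more
    representatives than codes. *)
Lemma cardinal_representatives (T J : Type) (r : T -> J -> Prop) :
  exists E : set T, cardinal_le E J /\
    forall x j, r x j -> exists2 y, E y & r y j.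
Proof.
exists [set y | exists j (ex : exists x, r x j), y = sval (cid ex)]; split.
  apply: (@cardinal_le_rel _ _ (fun (y : set_type _) j =>
    exists ex : exists x, r x j, \val y = sval (cid ex))).
    by move=> y; exact: set_mem (valP y).
  move=> y y' j [ex yE] [ex' yE']; apply/val_inj.
  by rewrite yE yE' (Prop_irrelevance ex ex').
move=> x j rxj; pose ex := ex_intro (r^~ j) x rxj.
by exists (sval (cid ex)); [exists j, ex|case: cid].
Qed.

Lemma cardinal_exp_le_weak_exp (l m : cardinal) : cardinal_lt m l ->
  cardinal_le (cardinal_exp bool m) (cardinal_weak_exp bool l).
Proof.
move=> ml; have [+ _] := cardinal_supP (cardinal_weak_exp_bounded l).
by apply; exists m.
Qed.

(** If 2^{<l} were below l, it would be one of the exponents, and its own power set would embed in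
    it, against Cantor. *)
Lemma cardinal_le_weak_exp (l : cardinal) :
  cardinal_le l (cardinal_weak_exp bool l).
Proof.
apply: contrapT => /cardinal_ltNle /cardinal_exp_le_weak_exp.
by have [_] := cardinal_lt_pow (cardinal_weak_exp bool l).
Qed.

(** For infinite m a function is determined by its graph, a subset of m * nat, which has size m. For
    finite m there are only countably many functions. *)
Lemma cardinal_exp_count_le_weak_exp (Z : countType) (l m : cardinal) :
  cardinal_le aleph0 l -> cardinal_lt m l ->
  cardinal_le (cardinal_exp Z m) (cardinal_weak_exp bool l).
Proof.
move=> l0 ml.
have [m0|] := pselect (cardinal_le aleph0 m).
  apply: (@cardinal_le_trans (cardinal_exp bool (cardinal_mul m nat))).
    apply/cardinal_leP.
    exists (fun f p => pickle (f p.1) == p.2) => f f' ff'; apply/funext => x.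
    move/(congr1 (@^~ (x, pickle (f x)))): ff' => /=.
    by rewrite eqxx => /esym/eqP/(pcan_inj pickleK).
  apply: cardinal_exp_le_weak_exp.
  exact: cardinal_le_lt_trans (cardinal_mul_le m0 (cardinal_lexx _) m0) ml.
move=> /finite_setPn/finite_setP[n mn].
apply: cardinal_le_trans (cardinal_le_weak_exp l).
apply: cardinal_le_trans l0.
have /cardinal_leP[g ginj] : cardinal_le m 'I_n.
  by rewrite /cardinal_le -(card_le_eqr card_II);
    move: mn; rewrite card_eq_le => /andP[].
apply: (@cardinal_le_rel _ _ (fun f k => exists2 h : {ffun 'I_n -> option Z},
    k = pickle h & forall x, h (g x) = Some (f x))) => [f|f f' k [h -> hf]].
  pose h : {ffun 'I_n -> option Z} := [ffun i =>
    if pselect (exists x, g x = i) is left gi then Some (f (sval (cid gi)))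
    else None].
  exists (pickle h), h => // x; rewrite ffunE.
  by case: pselect => [gx|[]]; [case: cid => y /= /ginj ->|exists x].
move=> [h' /(pcan_inj pickleK) <- hf']; apply/funext => x.
by have := hf x; rewrite hf' => -[].
Qed.

(** * Separated subsets of metric spaces *)

(** Cover S by open sets meeting T in at most one point: distinct points of T lie in distinct
    members of any subcover, and some subcover has fewer members than the least cardinal in
    [delta S]. *)
Lemma discrete_lt_delta (X : topologicalType) (S T : set X) : T `<=` S ->
  (forall x, S x -> exists V, [/\ open V, V x &
    forall s t, T s -> T t -> V s -> V t -> s = t]) ->
  cardinal_lt T (delta S).
Proof.
move=> TS discr.
pose U := [set (set_val : S -> X) @^-1` V | V in [set V : set X | open V /\
    forall s t, T s -> T t -> V s -> V t -> s = t]].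
have [cov _] := cardinal_minP (delta_nonempty S).
have [u [V [oV _] <-]||V [VU Vcov Vlt]] := cov U.
- by exists V.
- apply/seteqP; split=> // x _.
  have [V [oV Vx Vdisc]] := discr _ (set_mem (valP x)).
  by exists (set_val @^-1` V) => //; exists V.
have TV : cardinal_le T V.
  apply: (@cardinal_le_rel _ _ (fun (t : T) (v : V) =>
      exists2 s : S, \val s = \val t & \val v s)) => [t|t t' v].
    have St : S (\val t) by exact: TS (set_mem (valP t)).
    have /(_ (SigSub (mem_set St)))[] : forall s, (\bigcup_(v in V) v) s.
      by rewrite Vcov.
    move=> v Vv vt; exists (SigSub (mem_set Vv)).
    by exists (SigSub (mem_set St)).
  move=> [s st vs] [s' st' vs']; apply/val_inj.
  have [W [_ Wdisc] Wv] := VU _ (set_mem (valP v)).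
  apply: Wdisc; [exact: set_mem (valP t)|exact: set_mem (valP t')| |].
  - by rewrite -st -[W _]/((set_val @^-1` W) s) Wv.
  - by rewrite -st' -[W _]/((set_val @^-1` W) s') Wv.
apply: (cardinal_le_lt_trans TV); apply: (cardinal_lt_le_trans Vlt).
by apply/cardinal_leP; exists inr => ? ? [].
Qed.

Lemma aleph0_le_delta (Y : topologicalType) : cardinal_le aleph0 (delta Y).
Proof. by apply/cardinal_leP; exists inl => ? ? []. Qed.

Definition uniformly_separated {R : realType} {X : metricType R}
    (e : R) (A : set X) :=
  forall x y, A x -> A y -> mdist x y < e -> x = y.

Lemma separated_net {R : realType} {X : metricType R} (S : set X) (e : R) :
  0 < e -> exists A : set X, [/\ A `<=` S, uniformly_separated e A &
    forall x, S x -> exists2 a, A a & mdist a x < e].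
Proof.
move=> e0; pose P (A : set X) := A `<=` S /\ uniformly_separated e A.
have [F FP Ftot|A [[AS Asep] Amax]] := @Zorn_bigcup _ P.
  split=> [x [A /FP[AS _]]|x y [A FA Ax] [B FB By]]; first exact: AS.
  have [AB|BA] := Ftot _ _ FA FB.
  - by have [_] := FP _ FB; apply => //; exact: AB.
  - by have [_] := FP _ FA; apply => //; exact: BA.
exists A; split=> // x Sx; apply: contrapT => nA.
have far a : A a -> ~ mdist a x < e by move=> Aa ax; apply: nA; exists a.
apply: (Amax (A `|` [set x])); split.
- by move=> ?; left.
- move=> /(_ x (or_intror erefl)) /far; rewrite mdistxx; exact.
- by move=> y [/AS|->].
- move=> y z [Ay|->] [Az|->] //.
  + exact: Asep.
  + by move=> /far -/(_ Ay).
  + by rewrite metric_sym => /far -/(_ Az).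
Qed.

(** Two points of A within e/2 of x coincide, so at most one point b other than x has to be
    excluded, by the radius [mdist x b]. *)
Lemma separated_isolated {R : realType} {X : metricType R} (A : set X) (e : R)
    (x : X) : 0 < e -> uniformly_separated e A ->
  exists2 d, 0 < d & forall a, A a -> mdist x a < d -> a = x.
Proof.
move=> e0 Asep.
have [[b [Ab xb bx]]|nb] := pselect
    (exists b, [/\ A b, mdist x b < e / 2 & b <> x]).
  exists (mdist x b); first by rewrite mdist_gt0; apply/eqP => /esym.
  move=> a Aa xa; suff ab : a = b by move: xa; rewrite ab ltxx.
  apply: Asep => //; rewrite [e]splitr.
  rewrite (le_lt_trans (metric_triangle _ x _))// ltrD// metric_sym.
  exact: lt_trans xb.
exists (e / 2) => [|a Aa xa]; first exact: divr_gt0.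
by apply: contrapT => ax; apply: nb; exists a.
Qed.

(** The hypothesis says that T is closed and discrete relative to S. *)
Lemma isolated_lt_delta {R : realType} {X : metricType R} (S T : set X) :
  T `<=` S ->
  (forall x, S x ->
    exists2 d : R, 0 < d & forall t, T t -> mdist x t < d -> t = x) ->
  cardinal_lt T (delta S).
Proof.
move=> TS iso; apply: discrete_lt_delta => // x /iso[d d0 dP].
exists (ball x d)^°; split; [exact: open_interior|exact: nbhsx_ballx|].
have xV t : T t -> (ball x d)^° t -> t = x.
  by move=> Tt /interior_subset; rewrite ballEmdist; exact: dP.
by move=> s t Ts Tt /(xV _ Ts) -> /(xV _ Tt) ->.
Qed.

(** Near x only finitely many T n occur, and each of them isolates x. The least of finitely many
    radii works, even if the separation constants tend to 0. *)
Lemma locally_finite_lt_delta {R : realType} {X : metricType R} (S : set X)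
    (T : nat -> set X) (e : nat -> R) :
  (forall n, [/\ T n `<=` S, 0 < e n & uniformly_separated (e n) (T n)]) ->
  (forall x, S x -> exists (d : R) (N : nat), 0 < d /\
    forall n y, (N <= n)%N -> T n y -> d <= mdist x y) ->
  cardinal_lt (\bigcup_n T n) (delta S).
Proof.
move=> Tsep locf; apply: isolated_lt_delta => [x [n _]|x Sx].
  by have [+ _ _] := Tsep n; exact.
have [d [N [d0 Nd]]] := locf _ Sx.
have [c c0 cP] : exists2 c, 0 < c &
    forall n t, (n < N)%N -> T n t -> mdist x t < c -> t = x.
  elim: N {Nd} => [|N [c c0 cP]]; first by exists 1.
  have [_ eN sepN] := Tsep N; have [b b0 bP] := separated_isolated x eN sepN.
  exists (Num.min b c); first by rewrite lt_min b0.
  move=> n t; rewrite ltnS leq_eqVlt lt_min => /orP[/eqP->|nN] Tt /andP[xb xc].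
    exact: bP.
  exact: cP nN Tt xc.
exists (Num.min c d); first by rewrite lt_min c0.
move=> t [n _ Tt]; rewrite lt_min => /andP[xc xd].
have [nN|Nn] := ltnP n N; first exact: cP nN Tt xc.
by have := Nd _ _ Nn Tt; rewrite leNgt xd.
Qed.

Lemma natSinv_small {R : realType} (r : R) : 0 < r ->
  exists N, forall n, (N <= n)%N -> n.+1%:R^-1 < r.
Proof.
by move=> r0; have [N _ NP] := near_infty_natSinv_lt (PosNum r0); exists N.
Qed.

Lemma near_dense {R : realType} {X : metricType R} (F : set X)
    (M : nat -> set X) :
  (forall n x, F x -> exists2 a, M n a & mdist a x < n.+1%:R^-1) ->
  forall x (r : R), F x -> 0 < r ->
    exists2 a, (\bigcup_n M n) a & mdist a x < r.
Proof.
move=> net x r Fx /natSinv_small[n /(_ n (leqnn _)) nr].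
have [a Ma ax] := net n x Fx; exists a; first by exists n.
exact: lt_trans nr.
Qed.

(** If it failed, the union of suitable sets T n inside the F n would be a single cardinal below l
    bounding every A n. The union of all the A n would then be smaller than l and dense in S, a
    contradiction. *)
Lemma small_dense_remainder {R : realType} {X : metricType R} (S : set X)
    (A F : nat -> set X) (l : cardinal) : cardinal_le (delta S) l ->
  (forall n, [/\ A n `<=` S, uniformly_separated n.+1%:R^-1 (A n) &
    forall x, S x -> exists2 a, A n a & mdist a x < n.+1%:R^-1]) ->
  (forall n, F n `<=` S) ->
  (forall x, S x -> exists (d : R) (N : nat), 0 < d /\
    forall n y, (N <= n)%N -> F n y -> d <= mdist x y) ->
  exists n (D : set X), cardinal_lt D l /\
    forall x (r : R), F n x -> 0 < r -> exists2 a, D a & mdist a x < r.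
Proof.
move=> Sl AP FS Floc; apply: contrapT => nsmall.
have l0 : cardinal_le aleph0 l.
  exact: cardinal_le_trans (aleph0_le_delta _) Sl.
have small n (D : set X) : cardinal_lt D l ->
    ~ (forall x (r : R), F n x -> 0 < r -> exists2 a, D a & mdist a x < r).
  by move=> Dl DF; apply: nsmall; exists n, D.
have Al n : cardinal_lt (A n) l.
  apply: cardinal_lt_le_trans Sl; have [AS Asep _] := AP n.
  by apply: isolated_lt_delta => // x _; exact: separated_isolated Asep.
have ex n : exists T : set X * R, [/\ T.1 `<=` F n, T.1 !=set0, 0 < T.2,
    uniformly_separated T.2 T.1 &
    cardinal_le aleph0 (A n) -> cardinal_le (A n) T.1].
  have [A0|] := pselect (cardinal_le aleph0 (A n)).
    have net k : exists M : set X, [/\ M `<=` F n,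
        uniformly_separated k.+1%:R^-1 M &
        forall x, F n x -> exists2 a, M a & mdist a x < k.+1%:R^-1].
      exact: separated_net.
    pose M k := sval (cid (net k)).
    have MP k : [/\ M k `<=` F n, uniformly_separated k.+1%:R^-1 (M k) &
        forall x, F n x -> exists2 a, M k a & mdist a x < k.+1%:R^-1].
      by rewrite /M; case: cid.
    (* If all the nets M k of F n were at most as large as A n, their union would have fewer than l
       points and be dense in F n. *)
    have [[k Ak]|nAk] := pselect (exists k, cardinal_le (A n) (M k)).
      have [MF Msep _] := MP k; exists (M k, k.+1%:R^-1); split=> //=.
      have /cardinal_leP[h _] := cardinal_le_trans A0 Ak.
      by exists (\val (h 0%N)); exact: set_mem (valP (h 0%N)).
    have MA k : cardinal_le (M k) (A n).
      by have [//|Ak] := cardinal_le_total (M k) (A n); case: nAk; exists k.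
    case: (@small n (\bigcup_k M k)).
      exact: cardinal_le_lt_trans (cardinal_bigcup_le A0 A0 MA) (Al n).
    by apply: near_dense => k x Fx; have [_ _] := MP k; exact.
  (* For finite A n it is enough that T n be nonempty. *)
  move=> nA; have [[x Fx]|nF] := pselect (F n !=set0).
    by exists ([set x], 1); split=> //= [? ->//||y z -> -> //]; exists x.
  case: (@small n set0) => [|x r Fx]; last by case: nF; exists x.
  apply/cardinal_ltNle => /(cardinal_le_trans l0)/cardinal_leP[h _].
  by have := set_mem (valP (h 0%N)).
pose T n := (sval (cid (ex n))).1; pose e n := (sval (cid (ex n))).2.
have TP n : [/\ T n `<=` F n, T n !=set0, 0 < e n,
    uniformly_separated (e n) (T n) &
    cardinal_le aleph0 (A n) -> cardinal_le (A n) (T n)].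
  by rewrite /T /e; case: cid.
have Tl : cardinal_lt (\bigcup_n T n) l.
  apply: cardinal_lt_le_trans Sl; apply: (@locally_finite_lt_delta _ _ _ _ e).
    by move=> n; have [TF _ ? ? _] := TP n; split=> // x /TF /FS.
  move=> x /Floc[d [N [d0 dN]]]; exists d, N; split=> // n y Nn Ty.
  by apply: (dN n) => //; have [TF _ _ _ _] := TP n; exact: TF.
(* Each point of S leaves the F n from some index on. Were the union finite, no T m could contain
   any of its points for large m, yet T m is nonempty. *)
have T0 : cardinal_le aleph0 (\bigcup_n T n).
  apply: contrapT => /finite_setPn.
  rewrite (eq_finite_set (card_setT _)) => /finite_seqP[s sT].
  have ev t : exists N, S t -> forall n, T n t -> (n < N)%N.
    have [/Floc[d [N [d0 dN]]]|nSt] := pselect (S t); last by exists 0%N.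
    exists N => _ n Tnt; rewrite ltnNge; apply/negP => Nn.
    have [TF _ _ _ _] := TP n.
    by have := dN _ _ Nn (TF _ Tnt); rewrite mdistxx leNgt d0.
  pose N t := sval (cid (ev t)); pose m := (\max_(t <- s) N t)%N.
  have [TF [t Tt] _ _ _] := TP m.
  have ts : [set` s] t by rewrite -sT; exists m.
  have : (N t <= m)%N by exact: leq_bigmax_seq.
  rewrite leqNgt => /negP; apply.
  by rewrite /N; case: cid => k /= kP; apply: kP => //; exact/FS/TF.
have AT n : cardinal_le (A n) (\bigcup_n T n).
  have [A0|nA] := pselect (cardinal_le aleph0 (A n)).
    have [_ _ _ _ /(_ A0) /cardinal_le_trans] := TP n; apply.
    by apply: cardinal_le_subset => x Tx; exists n.
  have [A0|/nA//] := cardinal_le_total (A n) aleph0.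
  exact: cardinal_le_trans T0.
(* The index 0 is arbitrary: the union of the nets is dense in all of S. *)
apply: (@small 0%N (\bigcup_n A n)).
  exact: cardinal_le_lt_trans (cardinal_bigcup_le T0 T0 AT) Tl.
by move=> x r /FS; apply: near_dense => n y Sy; have [_ _] := AP n; exact.
Qed.

(** * Approximation on a shield *)

Lemma floor_eq_dist {R : realType} (e x y : R) : 0 < e ->
  Num.floor (x / e) = Num.floor (y / e) -> `|x - y| < e.
Proof.
move=> e0 xy; rewrite -[e in X in _ < X]mul1r -ltr_pdivrMr//.
rewrite -[X in _ / X](gtr0_norm e0) -normf_div mulrBl.
have := floor_itv (x / e); have := floor_itv (y / e); rewrite xy.
rewrite intrD => /andP[y1 y2] /andP[x1 x2].
rewrite ltr_norml; apply/andP; split; lra.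
Qed.

(** At such a point a, the single value f a determines f up to e on the part of S within r of a. *)
Definition steady {R : realType} {X : metricType R} (S : set X) (f : X -> R)
    (e r : R) : set X :=
  [set a | forall y, S y -> mdist a y < r -> `|f y - f a| < e].

(** Shows that the points of S not covered by steady net points eventually avoid a neighbourhood of
    x, as [small_dense_remainder] requires. *)
Lemma steady_near {R : realType} {X : metricType R} (S : set X) (f : X -> R)
    (e : R) (A : nat -> set X) (x : X) : continuous f -> 0 < e ->
  (forall n y, S y -> exists2 a, A n a & mdist a y < n.+1%:R^-1) ->
  exists (d : R) (N : nat), 0 < d /\ forall n y, (N <= n)%N -> S y ->
    mdist x y < d -> exists a, [/\ A n a, steady S f e n.+1%:R^-1 a &
      mdist a y < n.+1%:R^-1].
Proof.
move=> cf e0 net; have e20 : 0 < e / 2 by exact: divr_gt0.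
have /nbhs_ballP[r /= r0 xr] : \forall y \near x, `|f x - f y| < e / 2.
  exact: (@cvgr_dist_lt _ _ _ _ _ f (f x) (cf x) (e / 2)).
(* The chain x, y, a, z has three links, each shorter than r/3. *)
have r30 : 0 < r / 3 by exact: divr_gt0.
have [N Nr] := natSinv_small r30.
exists (r / 3), N; split=> // n y /Nr nr Sy xy.
have [a Aa ay] := net n y Sy; exists a; split=> // z Sz az.
have xa : mdist x a < r / 3 + r / 3.
  rewrite (le_lt_trans (metric_triangle _ y _))// ltrD//.
  by rewrite metric_sym (lt_trans ay).
have xz : mdist x z < r.
  rewrite (le_lt_trans (metric_triangle _ a _))//.
  have := lt_trans az nr; lra.
have xar : mdist x a < r by lra.
have := xr z; have := xr a; rewrite ballEmdist/= => /(_ xar) fa /(_ xz) fz.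
have -> : f z - f a = (f x - f a) - (f x - f z) by ring.
by rewrite (le_lt_trans (ler_normB _ _))// [e]splitr ltrD.
Qed.

(** If f and g share a code, every x in S is close to some a, in the net or in D, with f a and g a
    in the same rounding cell and both functions varying little between a and x. These are three
    errors, hence the choice 1/(j+1) < e/3. *)
Lemma dense_restrictions {R : realType} {X : metricType R} (S : set X)
    (l : cardinal) : cardinal_le (delta S) l ->
  exists E : set (continuousType X R),
    cardinal_le E (cardinal_weak_exp bool l) /\
    forall (f : continuousType X R) (e : R), 0 < e ->
      exists2 g, E g & forall x, S x -> `|f x - g x| < e.
Proof.
move=> Sl; set K := cardinal_weak_exp bool l.
have l0 : cardinal_le aleph0 l.
  exact: cardinal_le_trans (aleph0_le_delta _) Sl.
have K0 : cardinal_le aleph0 K.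
  exact: cardinal_le_trans (cardinal_le_weak_exp l).
have net n : exists A : set X, [/\ A `<=` S,
    uniformly_separated (n.+1%:R^-1 : R) A &
    forall x, S x -> exists2 a, A a & mdist a x < n.+1%:R^-1].
  exact: separated_net.
pose A n := sval (cid (net n)).
have AP n : [/\ A n `<=` S, uniformly_separated (n.+1%:R^-1 : R) (A n) &
    forall x, S x -> exists2 a, A n a & mdist a x < n.+1%:R^-1].
  by rewrite /A; case: cid.
have Al n : cardinal_lt (A n) l.
  apply: cardinal_lt_le_trans Sl; have [AS Asep _] := AP n.
  by apply: isolated_lt_delta => // x _; exact: separated_isolated Asep.
pose P n := A n -> option int.
(* A code consists of j (with e = 1/(j+1)), n, the partial function p on A_n  *)
(* giving the rounded values of f at its good points, and the rounded values  *)
(* of f on D n p, a small set whose closure contains what p leaves uncovered. *)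
pose rest n (p : P n) := [set x | S x /\
  forall a : A n, p a <> None -> n.+1%:R^-1 <= mdist (\val a) x].
pose covers n (p : P n) (D : set X) := cardinal_lt D l /\
  forall x (r : R), rest n p x -> 0 < r -> exists2 a, D a & mdist a x < r.
(* D depends on n and p only, so functions with the same code are compared on the same set. The
   default [set0] keeps D smaller than l for every p, as the count of codes needs. *)
have exD n (p : P n) : exists D : set X, cardinal_lt D l /\
    ((exists D, covers n p D) -> covers n p D).
  have [[D cD]|nD] := pselect (exists D, covers n p D).
    by exists D; split=> //; case: cD.
  exists set0; split=> //; apply/cardinal_ltNle => /(cardinal_le_trans l0).
  by move=> /cardinal_leP[h _]; have := set_mem (valP (h 0%N)).
pose D n p := sval (cid (exD n p)).
have Dl n p : cardinal_lt (D n p) l by rewrite /D; case: cid => ? [].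
have DP n p : (exists D, covers n p D) -> covers n p (D n p).
  by rewrite /D; case: cid => ? [].
pose code := (nat * {n & {p : P n & D n p -> int}})%type.
pose coded (f : continuousType X R) (c : code) :=
  let e : R := c.1.+1%:R^-1 in let n := projT1 c.2 in
  [/\ covers n (projT1 (projT2 c.2)) (D n (projT1 (projT2 c.2))),
      forall a, projT1 (projT2 c.2) a =
        if `[< steady S f e n.+1%:R^-1 (\val a) >]
        then Some (Num.floor (f (\val a) / e)) else None &
      forall d, projT2 (projT2 c.2) d = Num.floor (f (\val d) / e)].
have codeK : cardinal_le code K.
  apply: cardinal_mul_le => //; apply: cardinal_sigT_le => // n.
  apply: cardinal_sigT_le => // [|p]; exact: cardinal_exp_count_le_weak_exp.
have [E [EK EP]] := cardinal_representatives coded.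
exists E; split; first exact: cardinal_le_trans codeK.
move=> f e e0.
have e30 : 0 < e / 3 by exact: divr_gt0.
have [j /(_ j (leqnn j))] := natSinv_small e30.
set ej := j.+1%:R^-1 => eje; have ej0 : 0 < ej by rewrite invr_gt0.
pose p n : P n := fun a => if `[< steady S f ej n.+1%:R^-1 (\val a) >]
  then Some (Num.floor (f (\val a) / ej)) else None.
have [||n [D0 D0P]] :=
    @small_dense_remainder _ _ S A (fun n => rest n (p n)) _ Sl AP.
- by move=> n x [].
- move=> x Sx; have net' n y : S y -> exists2 a, A n a & mdist a y < n.+1%:R^-1.
    by have [_ _] := AP n; exact.
  have [d [N [d0 dN]]] := steady_near x (@cts_fun _ _ f) ej0 net'.
  exists d, N; split=> // n y Nn [Sy yp]; rewrite leNgt; apply/negP => xy.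
  have [a [Aa sa ay]] := dN _ _ Nn Sy xy.
  have := yp (SigSub (mem_set Aa)); rewrite /p /= => /(_ _)/le_lt_trans/(_ ay).
  by rewrite ltxx => H; apply/notF/H; case: asboolP.
have cov : covers n (p n) (D n (p n)) by apply: DP; exists D0.
pose c : code := (j, existT _ n (existT (fun p => D n p -> int) (p n)
  (fun d => Num.floor (f (\val d) / ej)))).
have [g Eg [_ /= gp gq]] := EP f c (And3 cov (fun=> erefl) (fun=> erefl)).
exists g => // x Sx.
have tri (a : X) : `|f x - f a| < ej -> `|g x - g a| < ej ->
    Num.floor (f a / ej) = Num.floor (g a / ej) -> `|f x - g x| < e.
  move=> fa ga /(floor_eq_dist ej0) fga.
  have -> : f x - g x = (f x - f a) - (g x - g a) + (f a - g a) by ring.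
  have := ler_normD ((f x - f a) - (g x - g a)) (f a - g a).
  have := ler_normB (f x - f a) (g x - g a).
  rewrite -/ej in eje; lra.
have [[a [pa ax]]|nax] := pselect (exists a : A n,
    p n a <> None /\ mdist (\val a) x < n.+1%:R^-1).
  (* Since the shared value at a is not [None], g is steady at a as well. *)
  have := gp a; move: pa; rewrite /p; case: asboolP => // fa _.
  case: asboolP => // ga [fga].
  by apply: (tri (\val a)) => //; [exact: fa|exact: ga].
have xrest : rest n (p n) x.
  by split=> // a pa; rewrite leNgt; apply/negP => ax; apply: nax; exists a.
(* Plain continuity at x suffices here, since D comes arbitrarily close to x. *)
have /nbhs_ballP[r /= r0 fr] : \forall y \near x, `|f x - f y| < ej.
  exact: (@cvgr_dist_lt _ _ _ _ _ f (f x) (@cts_fun _ _ f x) ej).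
have /nbhs_ballP[s /= s0 gs] : \forall y \near x, `|g x - g y| < ej.
  exact: (@cvgr_dist_lt _ _ _ _ _ g (g x) (@cts_fun _ _ g x) ej).
have rs0 : 0 < Num.min r s by rewrite lt_min r0.
have [_ /(_ _ _ xrest rs0)[d Dd]] := cov; rewrite lt_min => /andP[dr ds].
apply: (tri d).
- by apply: fr; rewrite ballEmdist/= metric_sym.
- by apply: gs; rewrite ballEmdist/= metric_sym.
- exact: (gq (SigSub (mem_set Dd))).
Qed.

(** * From shields to the whole bornology *)

Lemma delta1s_shield {R : realType} {X : metricType R} (A : set X) :
  exists S : set X, [/\ closed S, shield S A &
    cardinal_le (delta S) (delta1s A)].
Proof.
have [[S [cS sS SE]] _] := cardinal_minP (delta1s_nonempty A).
exists S; split=> //; rewrite /delta1s SE.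
by apply/cardinal_leP; exists inr => ? ? [].
Qed.

Lemma delta1s_le_bornology {R : realType} {X : metricType R} (B : bornology X)
    (A : set X) : bornology_sets B A ->
  cardinal_le (delta1s (closure A)) (delta1s_bornology B).
Proof.
move=> BA; have [ub _] := cardinal_supP (delta1s_bornology_bounded B).
apply: (cardinal_le_trans (ub _ (ex_intro _ A (conj BA erefl)))).
by apply/cardinal_leP; exists inr => ? ? [].
Qed.

Theorem theorem3p15 (R : realType) (X : metricType R) (B : bornology X)
    (hB : has_closed_base B) :
  cardinal_le (density (strong_continuous B))
    (cardinal_mul (cf B) (cardinal_weak_exp bool (delta1s_bornology B))).
Proof.
set l := delta1s_bornology B; set K := cardinal_weak_exp bool l.
have K0 : cardinal_le aleph0 K.
  apply: cardinal_le_trans (cardinal_le_weak_exp l).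
  by apply/cardinal_leP; exists inl => ? ? [].
have [[B0 [[B0B B0base] B0E]] _] := cardinal_minP (cf_nonempty B).
have B0cf : cardinal_le B0 (cf B).
  by rewrite /cf B0E; apply/cardinal_leP; exists inr => ? ? [].
have shields (A : B0) : exists S : set X, shield S (closure (\val A)) /\
    cardinal_le (delta S) l.
  have [S [_ sS Sd]] := delta1s_shield (closure (\val A)).
  exists S; split=> //; apply: (cardinal_le_trans Sd).
  exact/delta1s_le_bornology/B0B/set_mem/(valP A).
have ex (A : B0) : exists E : set (strong_continuous B), cardinal_le E K /\
    forall (f : continuousType X R) (e : R), 0 < e ->
      exists2 g : continuousType X R, E g & strong_entourage (\val A) e (f, g).
  have [S [sS /dense_restrictions[E [EK EP]]]] := shields A.
  exists E; split=> // f e /(EP f)[g Eg fg]; exists g => //.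
  have [|| d d0 Cd] := sS [set x | e <= `|f x - g x|].
  - rewrite -[X in closed X]/((fun x => `|f x - g x|) @^-1` [set y | e <= y]).
    apply: closed_comp => [x _|]; last exact: closed_ge.
    by apply: cvg_norm; apply: cvgB; exact: cts_fun.
  - by rewrite -subset0 => x [/= + /fg]; rewrite leNgt => /negP.
  exists d => // x [a Aa xa]; rewrite ltNge; apply/negP => efg.
  rewrite -[False]/(set0 x) -Cd; split=> //.
  by exists a => //; exact: subset_closure.
pose E A := sval (cid (ex A)).
have EP (A : B0) : cardinal_le (E A) K /\
    forall (f : continuousType X R) (e : R), 0 < e ->
      exists2 g : continuousType X R, E A g &
        strong_entourage (\val A) e (f, g).
  by rewrite /E; case: cid.
(* A basic neighbourhood given by A contains the one given by any larger A0 in the base. *)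
have Edense : dense (\bigcup_A E A).
  move=> O [f Of] Oo.
  have : nbhs f O by exact: open_nbhs_nbhs.
  rewrite nbhs_strongE => -[[A e] /= [/B0base[A0 B0A0 AA0] e0] AO].
  have [_ /(_ f e e0)[g Eg [d d0 fg]]] := EP (SigSub (mem_set B0A0)).
  exists g; split; last by exists (SigSub (mem_set B0A0)).
  by apply: AO; exists d => // x [a /AA0 Aa xa]; apply: fg; exists a.
have [_ /(_ (set_type (\bigcup_A E A)))] :=
  cardinal_minP (density_nonempty (strong_continuous B)).
move=> /(_ (ex_intro _ _ (conj Edense erefl))) dE.
have cf0 : cf B by exact: (inl 0%N).
have cfK0 : cardinal_le aleph0 (cardinal_mul (cf B) K).
  exact: cardinal_le_trans K0 (cardinal_le_mulr _ cf0).
(* The summand [aleph0] in the density is absorbed by the infinite product. *)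
apply: cardinal_add_le => //; apply: (cardinal_le_trans dE).
apply: cardinal_le_trans (cardinal_le_mul B0cf (cardinal_lexx K)).
by apply: cardinal_bigcup_le_mul => A; have [] := EP A.
Qed.
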